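(* Let $X$ be a proper CAT(0) space, $G<\mathrm{Isom}(X)$ a closed subgroup and $\xi\in\partial X$. Assume that $G_\xi$ acts cocompactly on $X$. Then for each $\xi'\in\mathrm{Opp}(\xi)$ we have a decomposition $$G_\xi = G_{\xi,\xi'}\cdot G_\xi^{\mathrm{u}}$$ which is almost semi-direct in the sense that $G_{\xi,\xi'}\cap G_\xi^{\mathrm{u}}$ is compact. In particular, $G_\xi^{\mathrm{u}}$ acts transitively on $\mathrm{Opp}(\xi)$.
   Context: A metric space is proper if its closed balls are compact; $\mathrm{Isom}(X)$ carries the compact-open topology; $\partial X$ is the visual boundary. A group acts cocompactly on $X$ if the translates of some compact subset cover $X$. $G_\xi$ is the stabiliser of $\xi$ in $G$ and $G_{\xi,\xi'}=G_\xi\cap G_{\xi'}$. $\mathrm{Opp}(\xi)$ is the set of points $\xi'\in\partial X$ for which there is a bi-infinite geodesic line in $X$ with extremities $\xi$ and $\xi'$. Define the closed normal subgroup of $G_\xi$ $$G_\xi^{\mathrm{u}}=\Big\{g\in G:\ \lim_{t\to\infty} d\big(g\cdot r(t), r(t)\big)=0\ \text{ for every geodesic ray } r\colon\mathbf{R}_+\to X \text{ with } r(\infty)=\xi\Big\}.$$ *)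

(* Defs.v *)
From mathcomp Require Import all_boot all_order all_algebra.
From mathcomp Require Import all_classical all_reals all_analysis.
Export numFieldNormedType.Exports.
Set Implicit Arguments.
Unset Strict Implicit.
Unset Printing Implicit Defensive.
Import Order.TTheory GRing.Theory Num.Theory.
Local Open Scope classical_set_scope.
Local Open Scope ring_scope.

Section Defs.
Context {R : realType} {X : metricType R}.

Definition geodesic_on (I : set R) (c : R -> X) : Prop :=
  forall s t, I s -> I t -> mdist (c s) (c t) = `|s - t|.

Definition geodesic_segment (x y : X) (c : R -> X) : Prop :=
  [/\ geodesic_on `[0, mdist x y] c, c 0 = x & c (mdist x y) = y].

(* Only the restriction to [0, +oo[ matters; the values at negative times are
   arbitrary. *)
Definition geodesic_ray (r : R -> X) : Prop := geodesic_on `[0, +oo[ r.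

Definition geodesic_line (c : R -> X) : Prop := geodesic_on setT c.

(* The norm of 'rV[R]_2 in the library is the sup norm, hence this. *)
Definition euclidean_dist (u v : 'rV[R]_2) : R :=
  Num.sqrt (\sum_(i < 2) (u 0 i - v 0 i) ^+ 2).

Definition comparison_triangle (x y z : X) (x' y' z' : 'rV[R]_2) : Prop :=
  [/\ euclidean_dist x' y' = mdist x y,
      euclidean_dist y' z' = mdist y z &
      euclidean_dist x' z' = mdist x z].

(* For every geodesic triangle, distances between points of two sides are at
   most the distances between their comparison points.  Since x, y, z are
   arbitrary it is enough to consider the two sides issued from x; on a single
   side the comparison is an equality. *)
Definition CAT0_inequality : Prop :=
  forall (x y z : X) (c1 c2 : R -> X) (x' y' z' : 'rV[R]_2),
    geodesic_segment x y c1 -> geodesic_segment x z c2 ->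
    comparison_triangle x y z x' y' z' ->
    forall a b : R, 0 <= a <= 1 -> 0 <= b <= 1 ->
      mdist (c1 (a * mdist x y)) (c2 (b * mdist x z)) <=
      euclidean_dist (x' + a *: (y' - x')) (x' + b *: (z' - x')).

Definition asymptotic (r1 r2 : R -> X) : Prop :=
  exists C : R, forall t, 0 <= t -> mdist (r1 t) (r2 t) <= C.

(* A boundary point is the set of all geodesic rays asymptotic to a given one;
   r(oo) = xi is membership of r in xi. *)
Definition endpoint (r : R -> X) : set (R -> X) :=
  [set r' | geodesic_ray r' /\ asymptotic r r'].

Definition boundary_act (g : X -> X) (xi : set (R -> X)) : set (R -> X) :=
  [set g \o r | r in xi].

Definition stabiliser (G : set {compact-open, X -> X}) (xi : set (R -> X)) :
    set {compact-open, X -> X} :=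
  [set g | G g /\ boundary_act g xi = xi].

Definition unipotent_part (G : set {compact-open, X -> X})
    (xi : set (R -> X)) : set {compact-open, X -> X} :=
  [set g | G g /\ forall r, geodesic_ray r -> xi r ->
                    mdist (g (r t)) (r t) @[t --> +oo] --> (0 : R)].

Definition cocompact_action (H : set {compact-open, X -> X}) : Prop :=
  exists2 K : set X, compact K & \bigcup_(g in H) (g @` K) = setT.

(* H preserves S and S is a single H-orbit. *)
Definition transitive_on_boundary (H : set {compact-open, X -> X})
    (S : set (set (R -> X))) : Prop :=
  forall eta, S eta -> [set boundary_act g eta | g in H] = S.

End Defs.

Section Spaces.
Context {R : realType}.

Definition proper_space (X : metricType R) : Prop :=
  forall (x : X) (e : R), compact [set y | mdist x y <= e].

Definition geodesic_space (X : metricType R) : Prop :=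
  forall x y : X, exists c : R -> X, geodesic_segment x y c.

Definition CAT0_space (X : metricType R) : Prop :=
  geodesic_space X /\ @CAT0_inequality R X.

Definition visual_boundary (X : metricType R) : set (set (R -> X)) :=
  [set endpoint r | r in @geodesic_ray R X].

Definition Opp (X : metricType R) (xi : set (R -> X)) : set (set (R -> X)) :=
  [set xi' | visual_boundary xi' /\
     exists c : R -> X,
       [/\ geodesic_line c, xi (fun t => c (- t)) & xi' c]].

Definition Isom (X : metricType R) : set {compact-open, X -> X} :=
  [set g | (forall x y, mdist (g x) (g y) = mdist x y) /\
           set_surj [set: X] [set: X] g].
#[global] Arguments Isom : clear implicits.

(* Closedness is relative to Isom X, with the compact-open topology. *)
Definition closed_isom_subgroup (X : metricType R)
    (G : set {compact-open, X -> X}) : Prop :=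
  [/\ G `<=` Isom X,
      G idfun,
      (forall g h, G g -> G h -> G (g \o h)),
      (forall g, G g -> exists2 h, G h & cancel g h) &
      closed (G : set (subspace (Isom X)))].

End Spaces.

(* Main.v *)
Require Import Defs.
From mathcomp Require Import all_boot all_order all_algebra.
From mathcomp Require Import all_classical all_reals all_analysis.
From mathcomp Require Import ring lra.
Set Implicit Arguments.
Unset Strict Implicit.
Unset Printing Implicit Defensive.
Import Order.TTheory GRing.Theory Num.Theory.
Local Open Scope classical_set_scope.
Local Open Scope ring_scope.

(* Let T_t move every point for time t along its ray towards xi: these maps are
   1-Lipschitz and commute with G_xi.  Let c be a line coming from xi' and going
   to xi.  By cocompactness, translates a_k c(-k) stay in a compact set; comparing
   the times -i and -j and flowing forward shows that suitable h in G_xi make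
   h T_{j-i} nearly the identity on all lines parallel to c at once.  A limit of
   the maps h T_{j-i} is a projection of X onto the union of these lines, and
   it moves each point x to some y with d(T_t x, T_t y) -> 0.  For two lines c1, c2
   the same indices (i, j) serve both, so the elements h2 h1^-1 stay bounded; a
   limit u of them intertwines the two projections, hence lies in G_xi^u and
   sends the origin of c1 to that of c2.  This is transitivity, from which the
   decomposition follows; an element of G_xi^u fixing both ends of c fixes c
   pointwise, which gives compactness.  Of the CAT(0) condition only the
   convexity of the metric is used. *)

(** * Limits along filters in metric spaces *)

Section MetricLimits.
Context {R : realType} {X : metricType R}.
Implicit Types (x y z : X).

Lemma mdist_cvgP {I : Type} (F : set_system I) {FF : Filter F} (f : I -> X) y :
  f @ F --> y <-> forall e, 0 < e -> \forall i \near F, mdist y (f i) < e.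
Proof.
split=> [/cvg_ballP fy e e0|fy].
  by have := fy _ e0; apply: filterS => i; rewrite ballEmdist.
by apply/cvg_ballP => e e0; apply: filterS (fy _ e0) => i; rewrite ballEmdist.
Qed.

Lemma cvg_mdist {I : Type} (F : set_system I) {FF : Filter F} (f g : I -> X) y z :
  f @ F --> y -> g @ F --> z -> mdist (f i) (g i) @[i --> F] --> mdist y z.
Proof.
move=> /mdist_cvgP fy /mdist_cvgP gz; apply/cvgrPdist_lt => e e0.
have e20 : 0 < e / 2 by rewrite divr_gt0.
apply: filterS2 (fy _ e20) (gz _ e20) => i yi zi.
have := metric_triangle y (f i) z; have := metric_triangle (f i) (g i) z.
have := metric_triangle (f i) y (g i); have := metric_triangle y z (g i).
rewrite (metric_sym (g i) z) (metric_sym (f i) y) ltr_norml; lra.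
Qed.

Lemma cvg_mdist_unique {I : Type} (F : set_system I) {FF : ProperFilter F}
    (f : I -> X) y z :
  f @ F --> y -> f @ F --> z -> y = z.
Proof. exact: (cvg_unique (@metric_hausdorff R X)). Qed.

Lemma cvg_mdist_le {I : Type} (F : set_system I) {FF : ProperFilter F}
    (f g : I -> X) y z (C : R) :
  f @ F --> y -> g @ F --> z ->
  (\forall i \near F, mdist (f i) (g i) <= C) -> mdist y z <= C.
Proof.
move=> fy gz fgC.
have /cvgrPdist_lt yz : mdist (f i) (g i) @[i --> F] --> mdist y z.
  exact: cvg_mdist.
apply/ler_addgt0Pl => e e0.
have [i [yzi Ci]] := filter_ex (filterI (yz _ e0) fgC).
move: yzi; rewrite ltr_norml; lra.
Qed.

(** Limits along a fixed ultrafilter replace the extraction of subsequences: one ultrafilter serves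
    all bounded families at once, so no diagonal argument is needed. *)
Lemma proper_ultra_cvg {I : Type} (F : set_system I) {FU : UltraFilter F}
    (f : I -> X) x (C : R) :
  proper_space X -> (\forall i \near F, mdist x (f i) <= C) ->
  exists y, f @ F --> y.
Proof.
move=> Xp xfC.
have [|y [_ yF]] := Xp x C (f @ F) _; first exact: xfC.
exists y => B By; have [//|FnB] := in_ultra_setVsetC (f @^-1` B) FU.
have [z [nBz Bz]] := yF (~` B) B FnB By.
by case: (nBz Bz).
Qed.

End MetricLimits.

(** * Convexity of the metric from the comparison inequality *)

Section Busemann.
Context {R : realType} {X : metricType R}.

Lemma euclidean_distE (u v : 'rV[R]_2) :
  euclidean_dist u v = Num.sqrt ((u 0 0 - v 0 0) ^+ 2 + (u 0 1 - v 0 1) ^+ 2).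
Proof.
rewrite /euclidean_dist big_ord_recl big_ord1.
by have -> : lift ord0 ord0 = 1 :> 'I_2 by exact/val_inj.
Qed.

Definition vec2 (a b : R) : 'rV[R]_2 := \row_(j < 2) (if j == 0 then a else b).

Lemma euclidean_dist_vec2 a b a' b' :
  euclidean_dist (vec2 a b) (vec2 a' b') = Num.sqrt ((a - a') ^+ 2 + (b - b') ^+ 2).
Proof. by rewrite euclidean_distE !mxE. Qed.

Lemma euclidean_dist_homothety (x y z : 'rV[R]_2) (a : R) : 0 <= a ->
  euclidean_dist (x + a *: (y - x)) (x + a *: (z - x)) = a * euclidean_dist y z.
Proof.
move=> a0; rewrite !euclidean_distE !mxE.
rewrite -[in RHS](ger0_norm a0) -sqrtr_sqr -sqrtrM ?sqr_ge0//.
by congr Num.sqrt; ring.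
Qed.

(** Place [x'] at the origin and [y'] on the first axis; the law of cosines then gives the abscissa
    of [z']. *)
Lemma comparison_triangle_exists (x y z : X) :
  exists x' y' z', comparison_triangle x y z x' y' z'.
Proof.
set A := mdist x y; set B := mdist x z; set C := mdist y z.
have A0 : 0 <= A by exact: mdist_ge0.
have B0 : 0 <= B by exact: mdist_ge0.
have C0 : 0 <= C by exact: mdist_ge0.
have tB : B <= A + C by exact: metric_triangle.
have tA : A <= B + C by rewrite /C (metric_sym y z) metric_triangle.
have tC : C <= A + B by rewrite /A (metric_sym x y) metric_triangle.
(* The abscissa of [z'] has denominator [2 * A], so a degenerate side is treated apart. *)
have [A_eq0|An0] := eqVneq A 0.
  have BC : B = C by lra.
  exists (vec2 0 0), (vec2 0 0), (vec2 B 0).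
  rewrite /comparison_triangle -/A -/B -/C !euclidean_dist_vec2 -BC A_eq0.
  by rewrite !(subr0, sub0r) expr0n/= !addr0 sqrtr0 sqrrN sqrtr_sqr ger0_norm.
have Ap : 0 < A by rewrite lt_neqAle eq_sym An0.
pose p := (A ^+ 2 + B ^+ 2 - C ^+ 2) / (2 * A).
(* This is where the triangle inequalities enter: the ordinate of [z'] is a true square root. *)
have pB : p ^+ 2 <= B ^+ 2.
  have A20 : 0 < 2 * A by lra.
  have pB1 : p <= B by rewrite ler_pdivrMr//; nra.
  have pB2 : - B <= p by rewrite ler_pdivlMr//; nra.
  nra.
exists (vec2 0 0), (vec2 A 0), (vec2 p (Num.sqrt (B ^+ 2 - p ^+ 2))).
rewrite /comparison_triangle -/A -/B -/C !euclidean_dist_vec2.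
have s2 : Num.sqrt (B ^+ 2 - p ^+ 2) ^+ 2 = B ^+ 2 - p ^+ 2.
  by rewrite sqr_sqrtr// subr_ge0.
split.
- by rewrite !(subr0, sub0r) sqrrN expr0n/= addr0 sqrtr_sqr ger0_norm.
- rewrite sub0r sqrrN s2 -[RHS](ger0_norm C0) -sqrtr_sqr; congr Num.sqrt.
  by rewrite /p; field.
- by rewrite !sub0r !sqrrN s2 addrC subrK sqrtr_sqr ger0_norm.
Qed.

(** With the same ratio on both sides, the comparison points are the images of [y'] and [z'] under
    the homothety of ratio [a] centred at [x']. *)
Lemma CAT0_busemann (x y z : X) (c1 c2 : R -> X) (a : R) :
  @CAT0_inequality R X ->
  geodesic_segment x y c1 -> geodesic_segment x z c2 -> 0 <= a <= 1 ->
  mdist (c1 (a * mdist x y)) (c2 (a * mdist x z)) <= a * mdist y z.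
Proof.
move=> cat0 c1P c2P a01.
have [x' [y' [z' xyz]]] := comparison_triangle_exists x y z.
apply: le_trans (cat0 _ _ _ _ _ _ _ _ c1P c2P xyz _ _ a01 a01) _.
rewrite euclidean_dist_homothety; last by case/andP: a01.
by case: xyz => _ -> _.
Qed.

End Busemann.

(** * Rays towards a boundary point *)

Section Rays.
Context {R : realType} {X : metricType R}.
Implicit Types (x y z : X) (c r : R -> X).

Lemma geodesic_segment_rev x y c : geodesic_segment x y c ->
  geodesic_segment y x (fun t => c (mdist x y - t)).
Proof.
case=> cgeo c0 c1; rewrite /geodesic_segment (metric_sym y x) subrr subr0.
split=> // s t; rewrite /= !in_itv/= => /andP[s0 s1] /andP[t0 t1].
rewrite cgeo/= ?in_itv/=; [|by apply/andP; split; lra..].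
by rewrite distrC; congr `|_|; ring.
Qed.

Lemma geodesic_rayE r s t : geodesic_ray r -> 0 <= s -> 0 <= t ->
  mdist (r s) (r t) = `|s - t|.
Proof. by move=> rP s0 t0; apply: rP; rewrite /= in_itv/= ?s0 ?t0. Qed.

Lemma geodesic_ray_segment r s t : geodesic_ray r -> 0 <= s -> s <= t ->
  geodesic_segment (r s) (r t) (fun u => r (s + u)).
Proof.
move=> rP s0 st; have t0 : 0 <= t by lra.
have dst : mdist (r s) (r t) = t - s.
  by rewrite geodesic_rayE// distrC ger0_norm ?subr_ge0.
rewrite /geodesic_segment dst addr0 subrKC; split=> // u v.
rewrite /= !in_itv/= => /andP[u0 _] /andP[v0 _].
by rewrite geodesic_rayE ?addr_ge0// opprD addrACA subrr add0r.
Qed.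

Lemma geodesic_ray_shift r s : geodesic_ray r -> 0 <= s ->
  geodesic_ray (fun u => r (s + u)).
Proof.
move=> rP s0 u v; rewrite /= !in_itv/= !andbT => u0 v0.
by rewrite geodesic_rayE ?addr_ge0// opprD addrACA subrr add0r.
Qed.

Lemma asymptotic_sym r1 r2 : asymptotic r1 r2 -> asymptotic r2 r1.
Proof. by case=> C h; exists C => t t0; rewrite metric_sym h. Qed.

Lemma asymptotic_trans r1 r2 r3 :
  asymptotic r1 r2 -> asymptotic r2 r3 -> asymptotic r1 r3.
Proof.
move=> [C h] [D k]; exists (C + D) => t t0.
by apply: le_trans (metric_triangle _ (r2 t) _) _; rewrite lerD ?h ?k.
Qed.

Lemma asymptotic_shift r s : geodesic_ray r -> 0 <= s ->
  asymptotic r (fun u => r (s + u)).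
Proof.
move=> rP s0; exists s => t t0.
by rewrite geodesic_rayE ?addr_ge0// opprD addrCA subrr addr0 normrN ger0_norm.
Qed.

Hypothesis X_CAT0 : CAT0_space X.

(** Cut the quadrilateral along the diagonal from [x1] to [y2] and apply the triangle case to each
    half, the second one read backwards. *)
Lemma geodesic_convex x1 y1 x2 y2 c1 c2 (a : R) :
  geodesic_segment x1 y1 c1 -> geodesic_segment x2 y2 c2 -> 0 <= a <= 1 ->
  mdist (c1 (a * mdist x1 y1)) (c2 (a * mdist x2 y2)) <=
    (1 - a) * mdist x1 x2 + a * mdist y1 y2.
Proof.
case: X_CAT0 => Xgeo cat0 c1P c2P /andP[a0 a1].
have [m mP] := Xgeo x1 y2.
have a01 : 0 <= a <= 1 by rewrite a0.
have b01 : 0 <= 1 - a <= 1 by apply/andP; split; lra.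
have h1 := CAT0_busemann cat0 c1P mP a01.
have := CAT0_busemann cat0 (geodesic_segment_rev mP) (geodesic_segment_rev c2P) b01.
rewrite (metric_sym y2 x1) (metric_sym y2 x2) => h2.
have revE (d : R) : d - (1 - a) * d = a * d by ring.
rewrite !revE in h2.
have := metric_triangle (c1 (a * mdist x1 y1)) (m (a * mdist x1 y2)) (c2 (a * mdist x2 y2)).
lra.
Qed.

(** A bounded convex function on a half-line is nonincreasing. *)
Lemma asymptotic_nonincr r1 r2 s t :
  geodesic_ray r1 -> geodesic_ray r2 -> asymptotic r1 r2 -> 0 <= s -> s <= t ->
  mdist (r1 t) (r2 t) <= mdist (r1 s) (r2 s).
Proof.
move=> r1P r2P [C rC] s0 st; apply/ler_addgt0Pl => e e0.
have C0 : 0 <= C by apply: le_trans (rC 0 _) => //; exact: mdist_ge0.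
have Ce : 0 <= C / e by rewrite divr_ge0// ltW.
(* [t] lies at the fraction [1 / k] of the interval from [s] to [T], so convexity gives the far end
   a weight [1 / k], and [k] is chosen so that [C / k <= e]. *)
pose k := C / e + 1; have k0 : 0 < k by rewrite /k; lra.
pose T := s + (t - s) * k.
have sT : s <= T by rewrite /T lerDl mulr_ge0 ?subr_ge0// ltW.
have T0 : 0 <= T by lra.
have kV : 0 <= k^-1 <= 1.
  by rewrite invr_ge0 ltW//= invf_le1// /k lerDr.
have := geodesic_convex (geodesic_ray_segment r1P s0 sT)
  (geodesic_ray_segment r2P s0 sT) kV.
rewrite !geodesic_rayE// [`|s - T|]distrC ger0_norm ?subr_ge0//.
have -> : k^-1 * (T - s) = t - s.
  by rewrite /T addrAC subrr add0r mulrC mulfK// gt_eqF.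
rewrite [s + _]addrC subrK => h; apply: le_trans h _.
rewrite addrC lerD//.
  have : mdist (r1 T) (r2 T) <= C by exact: rC.
  move=> /(ler_wpM2l (ltW _ : 0 <= k^-1)) h.
  apply: le_trans (h _) _; first by rewrite invr_gt0.
  rewrite mulrC ler_pdivrMr// /k mulrDr mulr1 mulrCA divff ?gt_eqF// mulr1.
  by rewrite lerDl ltW.
by rewrite ler_piMl ?mdist_ge0//; case/andP: kV => ? ?; lra.
Qed.

Hypothesis X_proper : proper_space X.

(** The ray is a limit of segments from [x] to the points [r0 n], whose lengths [L n] differ from
    [n] by at most [D]. *)
Lemma geodesic_ray_from r0 x : geodesic_ray r0 ->
  exists r, [/\ geodesic_ray r, asymptotic r0 r & r 0 = x].
Proof.
move=> r0P.
have [U [UU ooU]] := ultraFilterLemma (F := \oo) _.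
pose D := mdist x (r0 0).
pose L (n : nat) := mdist x (r0 n%:R).
have /choice[c cP] : forall n : nat, exists c, geodesic_segment x (r0 n%:R) c.
  by move=> n; exact: (X_CAT0.1 x _).
have LnD n : `|L n - n%:R| <= D.
  have := metric_triangle x (r0 0) (r0 n%:R).
  have := metric_triangle (r0 0) x (r0 n%:R).
  rewrite (metric_sym (r0 0) x) -/D -/(L n) geodesic_rayE// sub0r normrN normr_nat.
  by rewrite ler_norml => h1 h2; apply/andP; split; lra.
have largeL t : \forall n \near U, t <= L n.
  apply: ooU; near=> n.
  have tn : t + D <= n%:R by near: n; exact: nbhs_infty_ger.
  by have := LnD n; rewrite ler_norml => /andP[? ?]; lra.
have cE s t n : 0 <= s <= L n -> 0 <= t <= L n -> mdist (c n s) (c n t) = `|s - t|.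
  by move=> sL tL; case: (cP n) => h _ _; apply: h.
have c0 n : c n 0 = x by case: (cP n).
have L0 n : 0 <= L n by exact: mdist_ge0.
(* The value [x] at negative times is a mere default. *)
have /choice[r rP] : forall t, exists y, 0 <= t -> c n t @[n --> U] --> y.
  move=> t; have [t0|_] := leP 0 t; last by exists x.
  have [|y ty] := @proper_ultra_cvg _ _ _ U _ (c ^~ t) x t X_proper; last by exists y.
  apply: filterS (largeL t) => n tn.
  by rewrite -{1}(c0 n) cE ?lexx ?L0 ?t0// sub0r normrN ger0_norm.
exists r; split.
- move=> s t; rewrite /= !in_itv/= !andbT => s0 t0.
  have lim_st : mdist (c n s) (c n t) @[n --> U] --> mdist (r s) (r t).
    exact: cvg_mdist (rP _ s0) (rP _ t0).
  apply: (cvg_unique (@norm_hausdorff _ R) lim_st).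
  apply: cvg_near_cst.
  apply: filterS2 (largeL s) (largeL t) => n sn tn.
  by rewrite cE ?s0 ?t0.
- exists (D + D) => t t0.
  apply: (@cvg_mdist_le _ _ _ U _ (fun=> r0 t) (c ^~ t)); [exact: cvg_cst|exact: rP|].
  (* Compare the segment from [x] with [r0] on [[0, n]] at the common ratio [t / L n]. Convexity
     costs one [D], since the far ends coincide; replacing the time [t / L n * n] by [t] costs
     another. *)
  apply: filterS2 (largeL t) (largeL 1) => n tn n1.
  have a01 : 0 <= t / L n <= 1.
    by rewrite divr_ge0//= ler_pdivrMr ?mul1r//; lra.
  have := geodesic_convex (cP n) (geodesic_ray_segment r0P (lexx 0) (ler0n _ n)) a01.
  rewrite -/(L n) -/D mdistxx mulr0 addr0 add0r geodesic_rayE// sub0r normrN.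
  rewrite ger0_norm// divfK ?gt_eqF//; last by lra.
  rewrite metric_sym => h1.
  have h2 : mdist (r0 t) (r0 (t / L n * n%:R)) <= D.
    have tLn : 0 <= t / L n * n%:R by rewrite mulr_ge0//; case/andP: a01.
    rewrite geodesic_rayE//.
    have -> : t - t / L n * n%:R = t / L n * (L n - n%:R).
      by rewrite mulrBr divfK// gt_eqF//; lra.
    rewrite normrM ger0_norm; last by case/andP: a01.
    apply: le_trans (LnD n); rewrite ler_piMl//; by case/andP: a01.
  have := metric_triangle (r0 t) (r0 (t / L n * n%:R)) (c n t).
  have D0 : 0 <= D by exact: mdist_ge0.
  have : (1 - t / L n) * D <= D by rewrite ler_piMl//; case/andP: a01 => *; lra.
  lra.
- apply: (@cvg_mdist_unique _ _ _ U _ (c ^~ 0)); first exact: rP.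
  by under eq_fun do rewrite c0; exact: cvg_cst.
Unshelve. all: by end_near. Qed.

End Rays.

(** * The flow towards the boundary point *)

Section Flow.
Context {R : realType} {X : metricType R}.
Hypotheses (X_CAT0 : CAT0_space X) (X_proper : proper_space X).
Context {xi : set (R -> X)}.
Hypothesis xi_boundary : visual_boundary xi.

Lemma boundary_ray r : xi r -> geodesic_ray r.
Proof. by case: xi_boundary => r0 _ <- []. Qed.

Lemma boundary_asymptotic r r' : xi r -> xi r' -> asymptotic r r'.
Proof.
case: xi_boundary => r0 _ <- [_ h] [_ h'].
exact: asymptotic_trans (asymptotic_sym h) h'.
Qed.

Lemma boundary_mem r r' : xi r -> geodesic_ray r' -> asymptotic r r' -> xi r'.
Proof.
case: xi_boundary => r0 _ <- [_ h] r'P h'.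
by split=> //; exact: asymptotic_trans h h'.
Qed.

Lemma boundary_nonempty : exists r, xi r.
Proof.
case: xi_boundary => r0 r0P <-; exists r0; split=> //.
by exists 0 => t _; rewrite mdistxx.
Qed.

Lemma boundary_nonincr r r' s t : xi r -> xi r' -> 0 <= s -> s <= t ->
  mdist (r t) (r' t) <= mdist (r s) (r' s).
Proof.
move=> rx rx'; apply: asymptotic_nonincr => //.
- exact: boundary_ray. - exact: boundary_ray. - exact: boundary_asymptotic.
Qed.

Definition ray_flow (T : R -> X -> X) :=
  forall x, xi (fun t => T t x) /\ T 0 x = x.

Lemma ray_flow_exists : exists T, ray_flow T.
Proof.
have [r0 r0x] := boundary_nonempty.
have /choice[r rP] : forall x, exists r, xi r /\ r 0 = x.
  move=> x.
  have [r [rP r0r rx]] := geodesic_ray_from X_CAT0 X_proper x (boundary_ray r0x).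
  by exists r; split=> //; exact: boundary_mem r0x rP r0r.
by exists (fun t x => r x t).
Qed.

Context {T : R -> X -> X}.
Hypothesis T_flow : ray_flow T.

Lemma flow0 x : T 0 x = x. Proof. by case: (T_flow x). Qed.

Lemma flow_nonincr x y s t : 0 <= s -> s <= t ->
  mdist (T t x) (T t y) <= mdist (T s x) (T s y).
Proof. exact: boundary_nonincr (T_flow x).1 (T_flow y).1. Qed.

Lemma flow_lip x y t : 0 <= t -> mdist (T t x) (T t y) <= mdist x y.
Proof. by move=> t0; rewrite -{2}(flow0 x) -{2}(flow0 y) flow_nonincr. Qed.

(** Two rays of [xi] with the same origin are at distance 0 at time 0, and their distance cannot
    grow. *)
Lemma flow_uniq r t : xi r -> 0 <= t -> r t = T t (r 0).
Proof.
move=> rx t0; apply/mdist_positivity/eqP; rewrite eq_le mdist_ge0 andbT.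
have := boundary_nonincr rx (T_flow (r 0)).1 (lexx 0) t0.
by rewrite flow0 mdistxx.
Qed.

Lemma flow_add x s t : 0 <= s -> 0 <= t -> T s (T t x) = T (t + s) x.
Proof.
move=> s0 t0.
have tx : xi (fun u => T (t + u) x).
  have xx := (T_flow x).1; have xr := boundary_ray xx.
  apply: boundary_mem xx _ _.
    exact: (geodesic_ray_shift xr t0).
  exact: (asymptotic_shift xr t0).
by rewrite [RHS](flow_uniq tx s0) addr0.
Qed.

(** [g] carries the ray of [x] to a ray of [xi] issued from [g x], and there is only one. *)
Lemma flow_comm (g : X -> X) x t : (forall r, xi r -> xi (g \o r)) -> 0 <= t ->
  g (T t x) = T t (g x).
Proof.
move=> gx t0; have := flow_uniq (gx _ (T_flow x).1) t0.
by rewrite /= flow0.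
Qed.

End Flow.

(** * Limits of isometries *)

Section IsometryLimits.
Context {R : realType} {X : metricType R}.
Implicit Types (x y z : X).

Definition isometric (g : X -> X) := forall x y, mdist (g x) (g y) = mdist x y.

Lemma compact_mdist_bounded (K : set X) x : compact K ->
  exists C : R, forall y, K y -> mdist x y <= C.
Proof.
move=> /compact_near_coveringP Kcov.
suff /filter_ex[C KC] : \forall C \near +oo, K `<=` [set y | mdist x y <= C].
  by exists C => y /KC.
apply: (Kcov R +oo (fun C y => mdist x y <= C)) => y _.
exists (ball y 1, [set C | mdist x y + 1 <= C]) => /=.
  by split; [exact: nbhsx_ballx|exact: (nbhs_pinfty_ge (num_real _))].
move=> [z C] /= [yz xyC]; apply: le_trans (metric_triangle _ y _) _.
by move: yz; rewrite ballEmdist/=; lra.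
Qed.

Lemma cvg_isometric_app {I : Type} (F : set_system I) {FF : Filter F}
    (g : I -> X -> X) (f : I -> X) y z :
  (\forall i \near F, isometric (g i)) -> f @ F --> y ->
  g i y @[i --> F] --> z -> g i (f i) @[i --> F] --> z.
Proof.
move=> gi /mdist_cvgP fy /mdist_cvgP gz; apply/mdist_cvgP => e e0.
have e20 : 0 < e / 2 by rewrite divr_gt0.
apply: filterS3 gi (fy _ e20) (gz _ e20) => i gi yi zi.
have := metric_triangle z (g i y) (g i (f i)).
by rewrite gi; lra.
Qed.

Lemma isometric_limit {I : Type} (F : set_system I) {FF : ProperFilter F}
    (g : I -> X -> X) (h : X -> X) :
  (\forall i \near F, isometric (g i)) ->
  (forall x, g i x @[i --> F] --> h x) -> isometric h.
Proof.
move=> gi gh x y.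
have hxy : mdist (g i x) (g i y) @[i --> F] --> mdist (h x) (h y).
  exact: cvg_mdist (gh x) (gh y).
apply: (cvg_unique (@norm_hausdorff _ R) hxy); apply: cvg_near_cst.
by apply: filterS gi => i; exact.
Qed.

(** Isometries are equicontinuous, so pointwise convergence is uniform on compact sets. The
    near-covering form of compactness yields this from one ball around each point. *)
Lemma isometric_cvg_compact_open {I : Type} (F : set_system I) {FF : Filter F}
    (g : I -> {compact-open, X -> X}) (h : {compact-open, X -> X}) :
  (\forall i \near F, isometric (g i)) ->
  (forall x, g i x @[i --> F] --> h x) -> g @ F --> h.
Proof.
move=> gi gh; apply/compact_open_cvgP => K O /compact_near_coveringP Kcov Oo hKO.
suff : \forall i \near F, K `<=` [set x | O (g i x)].
  by apply: filterS => i gKO _ [x Kx <-]; exact: gKO.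
apply: (Kcov I F (fun i x => O (g i x))) => x Kx.
have : nbhs (h x) O by apply: open_nbhs_nbhs; split=> //; apply: hKO; exists x.
rewrite -nbhs_ballE => -[e /= e0 eO].
have e20 : 0 < e / 2 by rewrite divr_gt0.
have /mdist_cvgP/(_ _ e20) ghx := gh x.
exists (ball x (e / 2), [set i | isometric (g i) /\ mdist (h x) (g i x) < e / 2]) => /=.
  by split; [exact: nbhsx_ballx|exact: filterI].
move=> [y i] /= [xy [gi' hgi]]; apply: eO; rewrite ballEmdist/=.
have := metric_triangle (h x) (g i x) (g i y).
by move: xy; rewrite gi' ballEmdist/=; lra.
Qed.

End IsometryLimits.

(** * Limits in the group and in stabilisers of boundary points *)

Section Stabilisers.
Context {R : realType} {X : metricType R} {G : set {compact-open, X -> X}}.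
Hypotheses (X_proper : proper_space X) (G_closed : closed_isom_subgroup G).

Lemma subgroup_isometric g : G g -> isometric g.
Proof. by case: G_closed => Gi _ _ _ _ /Gi[]. Qed.

Lemma subgroup_comp g h : G g -> G h -> G (g \o h).
Proof. by case: G_closed => _ _ Gc _ _; exact: Gc. Qed.

Lemma subgroup_inv g : G g -> exists h, [/\ G h, cancel g h & cancel h g].
Proof.
move=> Gg; case: (G_closed) => _ _ _ /(_ _ Gg)[h Gh gK] _.
exists h; split=> // x; apply: mdist_positivity.
by rewrite -(subgroup_isometric Gh) gK mdistxx.
Qed.

(** An Arzela-Ascoli argument: control of a single orbit point bounds all the others. As [G] is
    closed only relative to [Isom X], the limit must first be shown surjective. *)
Lemma subgroup_ultra_limit {I : Type} (F : set_system I) {FU : UltraFilter F}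
    (g : I -> {compact-open, X -> X}) x (C : R) :
  (\forall i \near F, G (g i)) -> (\forall i \near F, mdist x (g i x) <= C) ->
  exists h, [/\ G h, forall y, g i y @[i --> F] --> h y & g @ F --> h].
Proof.
move=> Gg xC.
have isog : \forall i \near F, isometric (g i).
  by apply: filterS Gg => i; exact: subgroup_isometric.
have /choice[h gh] : forall y : X, exists z : X, g i y @[i --> F] --> z.
  move=> y; apply: (@proper_ultra_cvg _ _ _ F _ _ x (C + mdist x y) X_proper).
  apply: filterS2 isog xC => i gi xi.
  apply: le_trans (metric_triangle _ (g i x) _) _.
  by rewrite gi lerD2r.
have gh' : g @ F --> (h : {compact-open, X -> X}).
  exact: isometric_cvg_compact_open.
exists h; split=> //.
have hi : isometric h by exact: isometric_limit isog gh.
have hsurj : set_surj [set: X] [set: X] h.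
  move=> y _.
  (* The preimages of [y] under the [g i] stay bounded, and their limit is a preimage under [h]. For
     an index with [g i] outside [G] the value [y] is a default. *)
  have /choice[k kP] : forall i, exists z, G (g i) -> g i z = y.
    move=> i; have [Ggi|nGgi] := pselect (G (g i)); last by exists y.
    by have [k [_ _ kK]] := subgroup_inv Ggi; exists (k y).
  have [|z kz] := @proper_ultra_cvg _ _ _ F _ k x (C + mdist x y) X_proper.
    apply: filterS3 Gg isog xC => i Ggi gi xi.
    rewrite -(gi x (k i)) kP//.
    apply: le_trans (metric_triangle _ x _) _.
    by rewrite lerD2r metric_sym.
  exists z => //.
  apply: (@cvg_mdist_unique _ _ _ F _ (fun i => g i (k i))).
    exact: cvg_isometric_app kz (gh z).
  by apply: cvg_near_cst; apply: filterS Gg => i Ggi; rewrite kP.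
case: (G_closed) => GI _ _ _ /closed_subspaceP[V Vcl VG].
have : (V `&` Isom X) h.
  split; last exact: (conj hi hsurj).
  apply: (@closed_cvg _ {compact-open, X -> X} F _ g V Vcl _ h gh'); apply: filterS Gg => i Ggi.
  have : (V `&` Isom X) (g i) by rewrite VG; split=> //; exact: GI.
  by case.
by rewrite VG => -[].
Qed.

(** One ray decides: all rays of [xi] are asymptotic to [r], and isometries preserve asymptoticity.
    The inverse [k] gives the reverse inclusion. *)
Lemma boundary_act_eq (g k : X -> X) (xi eta : set (R -> X)) r :
  isometric g -> isometric k -> cancel g k -> cancel k g ->
  visual_boundary xi -> visual_boundary eta -> xi r -> eta (g \o r) ->
  boundary_act g xi = eta.
Proof.
move=> gi ki gK kK xiB etaB xir etagr.
have ray_comp f s : isometric f -> geodesic_ray s -> geodesic_ray (f \o s).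
  by move=> fi sP u v u0 v0; rewrite fi sP.
apply/seteqP; split=> [_ [s xis <-]|s etas].
  apply: (boundary_mem etaB etagr); first exact: ray_comp (boundary_ray xiB xis).
  have [C rsC] := boundary_asymptotic xiB xir xis.
  by exists C => t t0; rewrite gi rsC.
exists (k \o s); last by apply/funext => t /=; rewrite kK.
apply: (boundary_mem xiB xir); first exact: ray_comp (boundary_ray etaB etas).
have [C rsC] := boundary_asymptotic etaB etagr etas.
by exists C => t t0; rewrite -gi/= kK rsC.
Qed.

Lemma subgroup_boundary_act_eq g (xi eta : set (R -> X)) r :
  G g -> visual_boundary xi -> visual_boundary eta -> xi r -> eta (g \o r) ->
  boundary_act g xi = eta.
Proof.
move=> Gg xiB etaB xir etagr; have [k [Gk gK kK]] := subgroup_inv Gg.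
have gi := subgroup_isometric Gg; have ki := subgroup_isometric Gk.
exact: (boundary_act_eq gi ki gK kK xiB etaB xir etagr).
Qed.

Section Boundary.
Context {xi : set (R -> X)}.
Hypothesis xi_boundary : visual_boundary xi.

Lemma stabiliser_mem g r : stabiliser G xi g -> xi r -> xi (g \o r).
Proof. by case=> _ {2}<- xir; exists r. Qed.

Lemma stabiliser_inv g : stabiliser G xi g ->
  exists k, [/\ stabiliser G xi k, cancel g k & cancel k g].
Proof.
move=> gP; have [r xir] := boundary_nonempty xi_boundary.
have [k [Gk gK kK]] := subgroup_inv gP.1.
exists k; split=> //; split=> //.
apply: (subgroup_boundary_act_eq Gk xi_boundary xi_boundary (stabiliser_mem gP xir)).
by rewrite compA (_ : k \o g = id)//; apply/funext => x /=; rewrite gK.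
Qed.

Lemma stabiliser_comp g h : stabiliser G xi g -> stabiliser G xi h ->
  stabiliser G xi (g \o h).
Proof.
move=> gP hP; split; first exact: subgroup_comp gP.1 hP.1.
have [r xir] := boundary_nonempty xi_boundary.
apply: (subgroup_boundary_act_eq _ xi_boundary xi_boundary xir).
  exact: subgroup_comp gP.1 hP.1.
exact: (stabiliser_mem gP (stabiliser_mem hP xir)).
Qed.

Hypothesis X_CAT0 : CAT0_space X.

(** For [g i] fixing [xi], the distance from [r t] to [g i (r t)] is at most its value at time 0;
    this bound is uniform in [t] and survives the limit. *)
Lemma stabiliser_limit {I : Type} (F : set_system I) {FF : ProperFilter F}
    (g : I -> {compact-open, X -> X}) h :
  (\forall i \near F, stabiliser G xi (g i)) ->
  (forall x, g i x @[i --> F] --> h x) -> G h -> stabiliser G xi h.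
Proof.
move=> gP gh Gh; split=> //.
have [r xir] := boundary_nonempty xi_boundary.
apply: (subgroup_boundary_act_eq Gh xi_boundary xi_boundary xir).
have rP := boundary_ray xi_boundary xir.
apply: (boundary_mem xi_boundary xir).
  by move=> s t s0 t0; rewrite (subgroup_isometric Gh) rP.
exists (mdist (r 0) (h (r 0)) + 1) => t t0.
apply: (@cvg_mdist_le _ _ _ F _ (fun=> r t) (fun i => g i (r t))).
- exact: cvg_cst.
- exact: gh.
have /mdist_cvgP/(_ _ ltr01) := gh (r 0).
apply: filterS2 gP => i giP gi0.
have := boundary_nonincr X_CAT0 xi_boundary xir (stabiliser_mem giP xir) (lexx 0) t0.
have := metric_triangle (r 0) (h (r 0)) (g i (r 0)).
rewrite /=; lra.
Qed.

End Boundary.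
End Stabilisers.

(** * Recurrence of lines towards the boundary point *)

Section Recurrence.
Context {R : realType} {X : metricType R}.
Implicit Types (x y z : X) (c : R -> X) (p : nat * nat).

Definition lag p : R := p.2%:R - p.1%:R.

(* Any ultrafilter finer than the iterated limit "i -> U, then j -> U", for a
   free ultrafilter U on nat, has these properties. *)
Lemma recurrent_pairs : proper_space X ->
  exists F : set_system (nat * nat),
    [/\ UltraFilter F, forall N, \forall p \near F, N <= lag p &
      forall (f : nat -> X) x (C e : R), (forall i, mdist x (f i) <= C) ->
        0 < e -> \forall p \near F, mdist (f p.1) (f p.2) < e].
Proof.
move=> X_proper.
have [U [UU ooU]] := ultraFilterLemma (F := \oo) _.
pose F0 := [set A : set (nat * nat) |
  \forall i \near U, \forall j \near U, A (i, j)].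
have F0P : ProperFilter F0.
  split.
    by move=> F00; have [i /filter_ex[j]] := filter_ex (F00 : nbhs U _).
  split.
  - by rewrite /F0 /=; apply: filterE => i; apply: filterE.
  - move=> A B; rewrite /F0 /= => FA FB; apply: filterS2 FA FB => i.
    exact: filterS2.
  - move=> A B AB; rewrite /F0 /= => FA; apply: filterS FA => i.
    by apply: filterS => j; exact: AB.
have [F [FU F0F]] := ultraFilterLemma F0P.
exists F; split=> // [N|f x C e fC e0]; apply: F0F; rewrite /F0 /=.
  apply: filterE => i; apply: ooU.
  near=> j; rewrite /lag /= lerBrDr.
  by near: j; exact: nbhs_infty_ger.
have [|y /mdist_cvgP fy] := @proper_ultra_cvg _ _ _ U _ f x C X_proper.
  exact: filterE.
have e20 : 0 < e / 2 by rewrite divr_gt0.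
apply: filterS (fy _ e20) => i yi; apply: filterS (fy _ e20) => j yj /=.
have := metric_triangle (f i) y (f j).
by rewrite (metric_sym (f i) y); lra.
Unshelve. all: by end_near. Qed.

Context {G : set {compact-open, X -> X}} {xi : set (R -> X)} (T : R -> X -> X).
Hypotheses (X_proper : proper_space X) (X_CAT0 : CAT0_space X).
Hypotheses (G_closed : closed_isom_subgroup G) (xi_boundary : visual_boundary xi).
Hypothesis T_flow : @ray_flow R X xi T.

Local Notation H := (stabiliser G xi).

Lemma stabiliser_isometric g : H g -> isometric g.
Proof. by case=> Gg _; exact: subgroup_isometric G_closed _ Gg. Qed.

Lemma stabiliser_flow g x t : H g -> 0 <= t -> g (T t x) = T t (g x).
Proof.
move=> Hg t0; apply: (flow_comm X_CAT0 xi_boundary T_flow) t0 => r.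
exact: (stabiliser_mem Hg).
Qed.

Lemma flow_cvg {I : Type} (F : set_system I) {FF : Filter F} (f : I -> X) y t :
  0 <= t -> f @ F --> y -> T t (f i) @[i --> F] --> T t y.
Proof.
move=> t0 /mdist_cvgP fy; apply/mdist_cvgP => e e0.
apply: filterS (fy _ e0) => i; apply: le_lt_trans.
exact: (flow_lip X_CAT0 xi_boundary T_flow).
Qed.

(* Lines are oriented towards xi, opposite to the lines c in [Opp]. *)
Definition flow_line c := forall s t, 0 <= s -> T s (c t) = c (t + s).

Definition parallel c c' := exists C, forall t, mdist (c t) (c' t) <= C.

Definition flow_asymptotic x y :=
  forall e, 0 < e -> exists t0, forall t, t0 <= t -> mdist (T t x) (T t y) < e.

Lemma flow_line_nonincr c c' s t : flow_line c -> flow_line c' -> s <= t ->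
  mdist (c t) (c' t) <= mdist (c s) (c' s).
Proof.
move=> cP c'P st; have ts : 0 <= t - s by rewrite subr_ge0.
by have := flow_lip X_CAT0 xi_boundary T_flow (c s) (c' s) ts; rewrite cP// c'P// subrKC.
Qed.

Lemma flow_asymptotic_sym x y : flow_asymptotic x y -> flow_asymptotic y x.
Proof.
move=> xy e /xy[t0 h]; exists t0 => t /h.
by rewrite metric_sym.
Qed.

Lemma flow_asymptotic_trans x y z :
  flow_asymptotic x y -> flow_asymptotic y z -> flow_asymptotic x z.
Proof.
move=> xy yz e e0; have e20 : 0 < e / 2 by rewrite divr_gt0.
have [t1 h1] := xy _ e20; have [t2 h2] := yz _ e20.
exists (Num.max t1 t2) => t; rewrite ge_max => /andP[/h1 k1 /h2 k2].
by have := metric_triangle (T t x) (T t y) (T t z); lra.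
Qed.

Lemma stabiliser_flow_asymptotic g x y : H g ->
  flow_asymptotic x y -> flow_asymptotic (g x) (g y).
Proof.
move=> Hg xy e /xy[t0 h]; exists (Num.max t0 0) => t.
rewrite ge_max => /andP[/h + t_ge0].
by rewrite -!(stabiliser_flow _ Hg)// (stabiliser_isometric Hg).
Qed.

Context {F : set_system (nat * nat)} {FU : UltraFilter F}.
Hypothesis lag_oo : forall N, \forall p \near F, N <= lag p.
Hypothesis F_cauchy : forall (f : nat -> X) x (C e : R),
  (forall i, mdist x (f i) <= C) ->
  0 < e -> \forall p \near F, mdist (f p.1) (f p.2) < e.

(* The same h has to bring back all lines parallel to c, not only c: this is what
   makes the limit of [h p \o T (lag p)] the identity on them. *)
Definition recurrence c (h : nat * nat -> {compact-open, X -> X}) :=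
  (forall p, H (h p)) /\
  forall c', flow_line c' -> parallel c c' ->
    forall t, h p (c' (lag p + t)) @[p --> F] --> c' t.

Lemma flow_line_recurrence c : cocompact_action H -> flow_line c ->
  exists h, recurrence c h.
Proof.
move=> [K Kc HK] cP.
have /choice[a aP] : forall i : nat,
    exists a : {compact-open, X -> X}, H a /\ K (a (c (- i%:R))).
  move=> i; have : (\bigcup_(g in H) (g @` K)) (c (- i%:R)) by rewrite HK.
  case=> g Hg [k Kk gk]; have [a [Ha ga _]] := stabiliser_inv G_closed xi_boundary Hg.
  by exists a; split=> //; rewrite -gk ga.
have /choice[b bP] : forall i : nat, exists b : {compact-open, X -> X},
    [/\ H b, cancel (a i) b & cancel b (a i)].
  by move=> i; exact (stabiliser_inv G_closed xi_boundary (aP i).1).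
have [C KC] := compact_mdist_bounded (c 0) Kc.
(* b_j a_i brings the line at time t + (j - i) close to its position at time t,
   because a_i c'(-i) and a_j c'(-j) are close. *)
exists (fun p => b p.2 \o a p.1); split.
  move=> p; apply: (stabiliser_comp G_closed xi_boundary) (aP _).1.
  by case: (bP p.2).
move=> c' c'P [D cD] t; apply/mdist_cvgP => e e0.
(* The bound makes [F_cauchy] applicable to the points [a i (c' (- i))]. *)
have aC i : mdist (c 0) (a i (c' (- i%:R))) <= C + D.
  apply: le_trans (metric_triangle _ (a i (c (- i%:R))) _) _.
  rewrite lerD ?KC//; first by case: (aP i).
  by rewrite (stabiliser_isometric (aP i).1).
apply: filterS2 (F_cauchy aC e0) (lag_oo (- t)) => -[i j] /= aij ijt.
have jt : 0 <= t + j%:R.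
  by move: ijt; rewrite /lag/=; have : 0 <= i%:R :> R by []; lra.
have [Hb ab ba] := bP j.
rewrite -(stabiliser_isometric (aP j).1) ba metric_sym.
apply: le_lt_trans aij.
(* Both points are values of the flow at the same time [t + j], which commutes with [a i] and [a j]
   and is 1-Lipschitz. *)
have -> : c' (lag (i, j) + t) = T (t + j%:R) (c' (- i%:R)).
  by rewrite c'P// /lag/=; congr c'; ring.
have -> : c' t = T (t + j%:R) (c' (- j%:R)).
  by rewrite c'P//; congr c'; ring.
rewrite (stabiliser_flow _ (aP i).1)// (stabiliser_flow _ (aP j).1)//.
exact: (flow_lip X_CAT0 xi_boundary T_flow).
Qed.

(** [c' 0] is the projection of [x] onto the lines parallel to [c]. The whole line [c'] arises as a
    limit of moved rays because their origins recede to time [- lag p]. *)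
Lemma recurrent_projection c h x : flow_line c -> recurrence c h ->
  exists c', [/\ flow_line c', parallel c c',
    h p (T (lag p) x) @[p --> F] --> c' 0 & flow_asymptotic x (c' 0)].
Proof.
move=> cP [Hh hc].
have cc : parallel c c by exists 0 => t; rewrite mdistxx.
have hcx t : \forall p \near F,
    mdist (h p (c (lag p + t))) (h p (T (lag p + t) x)) <= mdist (c 0) x.
  apply: filterS (lag_oo (- t)) => p pt.
  have pt0 : 0 <= lag p + t by lra.
  rewrite (stabiliser_isometric (Hh p)) -[lag p + t]add0r -cP// add0r.
  exact: (flow_lip X_CAT0 xi_boundary T_flow).
have /choice[c' c'P] : forall t : R, exists y : X,
    h p (T (lag p + t) x) @[p --> F] --> y.
  move=> t.
  apply: (@proper_ultra_cvg _ _ _ F _ _ (c t) (mdist (c 0) x + 1) X_proper).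
  have /mdist_cvgP/(_ _ ltr01) := hc _ cP cc t.
  apply: filterS2 (hcx t) => p h1 h2.
  apply: le_trans (metric_triangle _ (h p (c (lag p + t))) _) _.
  by lra.
have c'line : flow_line c'.
  move=> s t s0; apply: (@cvg_mdist_unique _ _ _ F _
    (fun p => h p (T (lag p + (t + s)) x))); last exact: c'P.
  apply: cvg_trans (flow_cvg s0 (c'P t)); apply: near_eq_cvg => /=.
  apply: filterS (lag_oo (- t)) => p pt.
  by rewrite -(stabiliser_flow _ (Hh p))// (flow_add X_CAT0 xi_boundary T_flow)// ?addrA//; lra.
have c'par : parallel c c'.
  exists (mdist (c 0) x) => t; apply: cvg_mdist_le (hcx t) => //.
  exact: hc.
have c'0 : h p (T (lag p) x) @[p --> F] --> c' 0.
  by have := c'P 0; under eq_fun do rewrite addr0.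
exists c'; split=> // e e0.
(* c' is itself fixed by the limit of [h p \o T (lag p)], which preserves the
   limiting distance between orbits, so T_t x and T_t (c' 0) get close. *)
have c'0' : h p (c' (lag p)) @[p --> F] --> c' 0.
  by have := hc _ c'line c'par 0; under eq_fun do rewrite addr0.
have e20 : 0 < e / 2 by rewrite divr_gt0.
have /mdist_cvgP/(_ _ e20) lim1 := c'0.
have /mdist_cvgP/(_ _ e20) lim2 := c'0'.
(* A single index suffices, as the distance between flow orbits does not grow after time [lag p]. *)
have [p [[p1 p2] p0]] := filter_ex (filterI (filterI lim1 lim2) (lag_oo 0)).
exists (lag p) => t pt.
apply: le_lt_trans (flow_nonincr X_CAT0 xi_boundary T_flow x (c' 0) p0 pt) _.
rewrite -(stabiliser_isometric (Hh p)) c'line// add0r.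
have := metric_triangle (h p (T (lag p) x)) (c' 0) (h p (c' (lag p))).
by rewrite (metric_sym (h p _) (c' 0)); lra.
Qed.

(** The last bound holds for negative times too, so [u] carries the end of [c1] opposite to [xi] to
    that of [c2]. *)
Lemma unipotent_transport c1 c2 : cocompact_action H ->
  flow_line c1 -> flow_line c2 ->
  exists u, [/\ H u, forall x, flow_asymptotic (u x) x &
    forall t, mdist (u (c1 t)) (c2 t) <= mdist (c1 0) (c2 0)].
Proof.
move=> Hcoc c1P c2P.
have [h1 h1P] := flow_line_recurrence Hcoc c1P.
have [h2 h2P] := flow_line_recurrence Hcoc c2P.
have [Hh1 h1c] := h1P; have [Hh2 h2c] := h2P.
have /choice[k1 k1P] : forall p, exists k : {compact-open, X -> X},
    [/\ H k, cancel (h1 p) k & cancel k (h1 p)].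
  by move=> p; exact (stabiliser_inv G_closed xi_boundary (Hh1 p)).
have k1K p : cancel (h1 p) (k1 p) by case: (k1P p).
pose v p : {compact-open, X -> X} := h2 p \o k1 p.
have Hv p : H (v p).
  by apply: (stabiliser_comp G_closed xi_boundary) => //; case: (k1P p).
have vi : \forall p \near F, isometric (v p).
  by apply: filterE => p; exact: stabiliser_isometric.
have lim1 t : h1 p (c1 (lag p + t)) @[p --> F] --> c1 t.
  by apply: h1c => //; exists 0 => s; rewrite mdistxx.
have lim2 t : h2 p (c2 (lag p + t)) @[p --> F] --> c2 t.
  by apply: h2c => //; exists 0 => s; rewrite mdistxx.
have h2c12 t : \forall p \near F,
    mdist (h2 p (c1 (lag p + t))) (h2 p (c2 (lag p + t))) <= mdist (c1 0) (c2 0).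
  apply: filterS (lag_oo (- t)) => p pt.
  by rewrite (stabiliser_isometric (Hh2 p)); apply: flow_line_nonincr => //; lra.
(* Go from [c1 0] to [c2 0], then to [h2 p (c2 (lag p))], to [h2 p (c1 (lag p))], and to
   [v p (c1 0)]: the first and third steps cost at most the distance between the origins, the other
   two less than 1 each. *)
have [|u [Gu vu _]] := @subgroup_ultra_limit _ _ _ X_proper G_closed _ F _ v (c1 0)
    (2 + 2 * mdist (c1 0) (c2 0)) (filterE _ (fun p => (Hv p).1)).
  have /mdist_cvgP/(_ _ ltr01) l1 := lim1 0.
  have /mdist_cvgP/(_ _ ltr01) l2 := lim2 0.
  apply: filterS3 l1 l2 (h2c12 0) => p l1 l2 l12.
  have := stabiliser_isometric (Hv p) (c1 0) (h1 p (c1 (lag p + 0))).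
  rewrite {2}/v /= k1K.
  have := metric_triangle (c1 0) (c2 0) (v p (c1 0)).
  have := metric_triangle (c2 0) (h2 p (c2 (lag p + 0))) (v p (c1 0)).
  have := metric_triangle (h2 p (c2 (lag p + 0))) (h2 p (c1 (lag p + 0))) (v p (c1 0)).
  rewrite (metric_sym (h2 p (c2 _)) (h2 p (c1 _))) (metric_sym (h2 p (c1 _)) (v p _)).
  by lra.
have Hu : H u.
  apply: (@stabiliser_limit _ _ _ G_closed _ xi_boundary X_CAT0 _ F _ v) => //.
  exact: filterE.
exists u; split=> // [x|t].
- have [d1 [d1P _ xd1 xd1']] := recurrent_projection x c1P h1P.
  have [d2 [d2P _ xd2 xd2']] := recurrent_projection x c2P h2P.
  (* [v p] sends [h1 p (T (lag p) x)] to [h2 p (T (lag p) x)], so [u] intertwines the two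
     projections. Then [u x] is asymptotic to [u (d1 0) = d2 0], which is asymptotic to [x]. *)
  have ud : u (d1 0) = d2 0.
    apply: (@cvg_mdist_unique _ _ _ F _ (fun p => v p (h1 p (T (lag p) x)))).
      exact: cvg_isometric_app vi xd1 (vu _).
    by under eq_fun do rewrite /v /= k1K.
  apply: flow_asymptotic_trans (stabiliser_flow_asymptotic Hu xd1') _.
  by rewrite ud; exact: flow_asymptotic_sym.
- have l1 : v p (h1 p (c1 (lag p + t))) @[p --> F] --> u (c1 t).
    exact: cvg_isometric_app vi (lim1 t) (vu _).
  apply: (cvg_mdist_le _ (lim2 t) (h2c12 t)).
  by move: l1; under eq_fun do rewrite /v /= k1K.
Qed.

(** The same [h p] brings both lines back from time [lag p] to time 0, and at time [lag p] they are
    arbitrarily close. *)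
Lemma parallel_asymptotic_eq c c' : cocompact_action H ->
  flow_line c -> flow_line c' -> parallel c c' -> flow_asymptotic (c 0) (c' 0) ->
  c 0 = c' 0.
Proof.
move=> Hcoc cP c'P cc' asym.
have [h [Hh hc]] := flow_line_recurrence Hcoc cP.
have lim : h p (c (lag p + 0)) @[p --> F] --> c 0.
  by apply: hc => //; exists 0 => s; rewrite mdistxx.
have lim' := hc _ c'P cc' 0.
apply/mdist_positivity/eqP; rewrite eq_le mdist_ge0 andbT.
apply/ler_addgt0Pl => e e0; rewrite addr0.
apply: cvg_mdist_le lim lim' _.
have [t0 ht0] := asym _ e0.
apply: filterS2 (lag_oo t0) (lag_oo 0) => p pt0 p0.
have := ht0 _ pt0; rewrite cP// c'P// !add0r addr0.
by rewrite (stabiliser_isometric (Hh p)) => /ltW.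
Qed.

End Recurrence.

(** * The decomposition *)

Section Levi.
Context {R : realType} {X : metricType R}.
Context {G : set {compact-open, X -> X}} {xi : set (R -> X)} {T : R -> X -> X}.
Hypotheses (X_proper : proper_space X) (X_CAT0 : CAT0_space X).
Hypotheses (G_closed : closed_isom_subgroup G) (xi_boundary : visual_boundary xi).
Hypothesis T_flow : @ray_flow R X xi T.

Local Notation H := (stabiliser G xi).
Local Notation U := (unipotent_part G xi).

Lemma geodesic_line_flow_line c :
  geodesic_line c -> xi (fun t => c (- t)) -> flow_line T (fun t => c (- t)).
Proof.
move=> cP xic s t s0.
have dc u v : mdist (c u) (c v) = `|u - v| by exact: cP.
have xict : xi (fun u => c (- (t + u))).
  apply: (boundary_mem xi_boundary xic).
    by move=> u v _ _; rewrite dc distrC; congr `|_|; ring.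
  exists `|t| => u _; rewrite dc le_eqVlt; apply/orP; left; apply/eqP.
  by congr `|_|; ring.
by rewrite (flow_uniq X_CAT0 xi_boundary T_flow xict s0) addr0.
Qed.

Lemma unipotent_stabiliser : U `<=` H.
Proof.
move=> g [Gg gU]; have [r xir] := boundary_nonempty xi_boundary.
have rP := boundary_ray xi_boundary xir.
split=> //; apply: (subgroup_boundary_act_eq G_closed Gg xi_boundary xi_boundary xir).
have gi := subgroup_isometric G_closed Gg.
apply: (boundary_mem xi_boundary xir); first by move=> s t s0 t0; rewrite gi rP.
have /cvgrPdist_lt/(_ _ ltr01)[N [_ hN]] := gU _ rP xir.
(* From time [N] on the displacement is below 1. An earlier time [t] is compared with [M], at cost
   [2 * (M - t) + 1]. *)
pose M := Num.max (N + 1) 0.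
have M0 : 0 <= M by rewrite le_max lexx orbT.
have NM : N + 1 <= M by rewrite le_max lexx.
exists (2 * M + 1) => t t0.
have bound u : N < u -> mdist (r u) (g (r u)) < 1.
  by move=> /hN; rewrite sub0r normrN ger0_norm ?mdist_ge0// metric_sym.
have [Nt|tN] := ltP N t; first by have := bound _ Nt; rewrite /=; lra.
have NM' : N < M by lra.
have := bound _ NM'.
have := metric_triangle (r t) (r M) (g (r t)).
have := metric_triangle (r M) (g (r M)) (g (r t)).
rewrite gi !geodesic_rayE// (distrC t M) ger0_norm /=; lra.
Qed.

Lemma unipotent_flow_asymptotic g x : U g -> flow_asymptotic T (g x) x.
Proof.
move=> gU e e0; have gH := unipotent_stabiliser gU.
have xix := (T_flow x).1.
have /cvgrPdist_lt/(_ _ e0)[N [_ hN]] := gU.2 _ (boundary_ray xi_boundary xix) xix.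
exists (Num.max (N + 1) 0) => t; rewrite ge_max => /andP[Nt t0].
have := hN t; rewrite sub0r normrN ger0_norm ?mdist_ge0//.
rewrite -(stabiliser_flow X_CAT0 xi_boundary T_flow _ gH t0).
by apply; lra.
Qed.

(** Every ray of [xi] is the flow orbit of its origin, so the defining condition can be tested on
    orbits; this is the converse of [unipotent_flow_asymptotic]. *)
Lemma flow_asymptotic_unipotent g : H g ->
  (forall x, flow_asymptotic T (g x) x) -> U g.
Proof.
move=> gH gx; split=> [|r rP xir]; first by case: gH.
apply/cvgrPdist_lt => e e0; have [N hN] := gx (r 0) _ e0.
near=> t; rewrite sub0r normrN ger0_norm ?mdist_ge0//.
have t0 : 0 <= t by near: t; exact: nbhs_pinfty_ge.
rewrite (flow_uniq X_CAT0 xi_boundary T_flow xir t0).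
rewrite (stabiliser_flow X_CAT0 xi_boundary T_flow _ gH t0); apply: hN.
by near: t; exact: (nbhs_pinfty_ge (num_real _)).
Unshelve. all: by end_near. Qed.

Lemma unipotent_inv g k : U g -> H k -> cancel k g -> U k.
Proof.
move=> gU kH kK; apply: flow_asymptotic_unipotent => // x.
apply: flow_asymptotic_sym; rewrite -{1}(kK x).
exact: unipotent_flow_asymptotic.
Qed.

Lemma visual_boundary_act g eta : G g -> visual_boundary eta ->
  visual_boundary (boundary_act g eta).
Proof.
move=> Gg etaB; have [r etar] := boundary_nonempty etaB.
have gi := subgroup_isometric G_closed Gg.
have grP : geodesic_ray (g \o r).
  by move=> s t s0 t0; rewrite gi (boundary_ray etaB etar).
have grB : visual_boundary (endpoint (g \o r)) by exists (g \o r).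
rewrite (subgroup_boundary_act_eq G_closed Gg etaB grB etar)//.
by split=> //; exists 0 => t _; rewrite mdistxx.
Qed.

Lemma Opp_act g eta : H g -> Opp xi eta -> Opp xi (boundary_act g eta).
Proof.
move=> gH [etaB [c [cP cxi ceta]]]; split; first exact: visual_boundary_act gH.1 etaB.
exists (g \o c); split; last by exists c.
- by move=> s t s0 t0; rewrite (stabiliser_isometric G_closed gH) cP.
- exact: (stabiliser_mem gH cxi).
Qed.

Lemma unipotent_transitive xi1 xi2 : cocompact_action H ->
  Opp xi xi1 -> Opp xi xi2 -> exists2 u, U u & boundary_act u xi1 = xi2.
Proof.
move=> Hcoc [xi1B [c1 [c1P c1xi c1xi1]]] [xi2B [c2 [c2P c2xi c2xi2]]].
have [F [FU lag_oo Fcauchy]] := @recurrent_pairs R X X_proper.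
have [u [uH ux uc]] := unipotent_transport X_proper X_CAT0 G_closed xi_boundary
  T_flow lag_oo Fcauchy Hcoc
  (geodesic_line_flow_line c1P c1xi) (geodesic_line_flow_line c2P c2xi).
exists u; first exact: flow_asymptotic_unipotent.
apply: (subgroup_boundary_act_eq G_closed uH.1 xi1B xi2B c1xi1).
apply: (boundary_mem xi2B c2xi2).
  move=> s t s0 t0; rewrite (stabiliser_isometric G_closed uH).
  by rewrite (boundary_ray xi1B c1xi1).
exists (mdist (c1 0) (c2 0)) => t _; rewrite metric_sym.
by have := uc (- t); rewrite oppr0 opprK.
Qed.

(** The image of the line under [g] is parallel to it, because [g] fixes both ends, and asymptotic
    to it at the same parameter, because [g] is in [U]; hence the two agree at time 0. *)
Lemma unipotent_fixes_line g xi' c : cocompact_action H ->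
  geodesic_line c -> xi (fun t => c (- t)) -> visual_boundary xi' -> xi' c ->
  U g -> stabiliser G xi' g -> g (c 0) = c 0.
Proof.
move=> Hcoc cP cxi xi'B cxi' gU gH'.
have gH := unipotent_stabiliser gU.
have [F [FU lag_oo Fcauchy]] := @recurrent_pairs R X X_proper.
have clP := geodesic_line_flow_line cP cxi.
have gclP : flow_line T (fun t => g (c (- t))).
  by move=> s t s0; rewrite -(stabiliser_flow X_CAT0 xi_boundary T_flow _ gH s0) clP.
have := @parallel_asymptotic_eq R X G xi T X_CAT0 G_closed xi_boundary T_flow F _
  lag_oo Fcauchy _ _ Hcoc gclP clP.
rewrite oppr0; apply; last exact: unipotent_flow_asymptotic.
have [C cC] := boundary_asymptotic xi'B (stabiliser_mem gH' cxi') cxi'.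
(* After reversal, times [t <= 0] lie on the side of [xi'], where [g] fixing [xi'] gives the bound;
   on the side of [xi] the distance does not grow. *)
exists C => t; have [t0|t0] := leP t 0.
  by apply: cC; rewrite oppr_ge0.
apply: le_trans (cC 0 (lexx 0)).
have := flow_line_nonincr X_CAT0 xi_boundary T_flow gclP clP (ltW t0).
by rewrite oppr0.
Qed.

Lemma compact_unipotent_line_stabiliser xi' : cocompact_action H ->
  Opp xi xi' -> compact ((H `&` stabiliser G xi') `&` U).
Proof.
move=> Hcoc [xi'B [c [cP cxi cxi']]].
rewrite compact_ultra => F FU FA.
have GF : \forall g \near F, G g by apply: filterS FA => g [[[]]].
have HF : \forall g \near F, H g by apply: filterS FA => g [[]].
have HF' : \forall g \near F, stabiliser G xi' g by apply: filterS FA => g [[]].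
have UF : \forall g \near F, U g by apply: filterS FA => g [].
(* All these elements fix [c 0], hence the bound 0. *)
have [|h [Gh Fh Fh']] := subgroup_ultra_limit (g := id) (x := c 0) (C := 0)
    X_proper G_closed GF.
  apply: filterS2 UF HF' => g gU gH'.
  by rewrite (unipotent_fixes_line Hcoc cP cxi xi'B cxi' gU gH') mdistxx.
have hH : H h by exact: (stabiliser_limit G_closed xi_boundary X_CAT0 HF Fh Gh).
exists h; split=> //; split.
  by split=> //; exact: (stabiliser_limit G_closed xi'B X_CAT0 HF' Fh Gh).
apply: flow_asymptotic_unipotent => // x e e0.
have e20 : 0 < e / 2 by rewrite divr_gt0.
have /mdist_cvgP/(_ _ e20) hx := Fh x.
(* [U] is closed under this limit: choose [g] in [U] with [g x] near [h x]; the flow keeps them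
   near, and [T t (g x)] approaches [T t x]. *)
have [g [gx gU]] := filter_ex (filterI hx UF).
have [N hN] := unipotent_flow_asymptotic x gU e20.
exists (Num.max N 0) => t; rewrite ge_max => /andP[/hN Nt t0].
have := flow_lip X_CAT0 xi_boundary T_flow (h x) (g x) t0.
have := metric_triangle (T t (h x)) (T t (g x)) (T t x).
by lra.
Qed.

End Levi.

Theorem theorem10 (R : realType) (X : metricType R)
    (G : set {compact-open, X -> X}) (xi : set (R -> X))
    (X_proper : proper_space X) (X_CAT0 : CAT0_space X)
    (G_closed_subgroup : closed_isom_subgroup G)
    (xi_boundary : visual_boundary xi)
    (Gxi_cocompact : cocompact_action (stabiliser G xi)) :
  (forall xi' : set (R -> X), Opp xi xi' ->
     let Gxixi' := stabiliser G xi `&` stabiliser G xi' in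
     stabiliser G xi =
       [set h \o u | h in Gxixi' & u in unipotent_part G xi] /\
     compact (Gxixi' `&` unipotent_part G xi)) /\
  transitive_on_boundary (unipotent_part G xi) (Opp xi).
Proof.
have [T T_flow] := ray_flow_exists X_CAT0 X_proper xi_boundary.
have UH := unipotent_stabiliser G_closed_subgroup xi_boundary.
have transitive := unipotent_transitive X_proper X_CAT0 G_closed_subgroup
  xi_boundary T_flow Gxi_cocompact.
have Hcomp := @stabiliser_comp _ _ _ G_closed_subgroup _ xi_boundary.
split=> [xi' xi'Opp Gxixi'|eta etaOpp].
  split; last exact: compact_unipotent_line_stabiliser T_flow _ Gxi_cocompact xi'Opp.
  apply/seteqP; split=> [g gH|_ [h [hH _] [u uU <-]]]; last exact: Hcomp hH (UH _ uU).
  have [k [kH gK kK]] := stabiliser_inv G_closed_subgroup xi_boundary gH.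
  (* [v] sends [xi'] where the inverse [k] of [g] does, so [g \o v] fixes [xi'], and [g] is this
     element followed on the right by the inverse of [v]. *)
  have [v vU vxi'] := transitive _ _ xi'Opp (Opp_act G_closed_subgroup kH xi'Opp).
  have [w [wH vK wK]] := stabiliser_inv G_closed_subgroup xi_boundary (UH _ vU).
  exists (g \o v); last first.
    exists w; last by apply/funext => x /=; rewrite wK.
    exact: (unipotent_inv X_CAT0 G_closed_subgroup xi_boundary T_flow vU wH wK).
  split; first exact: Hcomp gH (UH _ vU).
  split; first exact: (Hcomp _ _ gH (UH _ vU)).1.
  have -> : boundary_act (g \o v) xi' = boundary_act g (boundary_act v xi').
    by rewrite /boundary_act image_comp.
  rewrite vxi' /boundary_act image_comp.
  rewrite (_ : _ \o _ = id) ?image_id//.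
  by apply/funext => r /=; apply/funext => t /=; rewrite kK.
apply/seteqP; split=> [_ [g gU <-]|eta' eta'Opp].
  exact: (Opp_act G_closed_subgroup (UH _ gU) etaOpp).
by have [u uU ueta] := transitive _ _ etaOpp eta'Opp; exists u.
Qed.
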